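(* Let $M$ be either the complement in $S^3$ of an oriented link, or a closed, connected, orientable 3-manifold, represented in $S^3$ by the closure of a fixed braid $B\in B_m$, $m\ge 1$, and let $n\ge 1$. Then the set $C_{m,n}\subseteq B_{m+n}$ of all mixed braids on $m+n$ strands associated to $M$ (that is, with fixed subbraid $B$ on the first $m$ strands) is a coset of the subgroup $B_{m,n}$ in $B_{m+n}$; i.e. there is $g\in B_{m+n}$ with $C_{m,n}=B_{m,n}\cdot g$.
   Context: $B_k$ denotes the classical Artin braid group on $k$ strands with product given by concatenation. Representation of $M$: if $M=S^3\setminus K$ is a link complement, $B\in B_m$ is a fixed braid whose closure is $K$; if $M$ is a closed, connected, orientable 3-manifold, $B\in B_m$ is a fixed braid whose closure, with some integer framing, is a surgery link for $M$ in $S^3$. $B_{m,n}\le B_{m+n}$ is the subgroup of all braids on $m+n$ strands such that, if the last $n$ strands are removed, what is left is the identity braid on the first $m$ strands (in particular the first $m$ strands begin and end at the positions $1,\ldots,m$, strand $i$ ending at position $i$). A mixed braid on $m+n$ strands associated to $M$ is an element of $B_{m+n}$ whose induced permutation maps $\{1,\ldots,m\}$ to itself (hence also $\{m+1,\ldots,m+n\}$ to itself), and such that the subbraid formed by the first $m$ strands (obtained by removing the last $n$ strands) is the fixed braid $B\in B_m$. $C_{m,n}$ denotes the set of all such mixed braids. *)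

(* Defs.v *)
From HB Require Import structures.
From mathcomp Require Import all_boot all_fingroup.
From mathcomp Require Import boolp classical_sets.
From mathcomp Require Import ssrint zify.

Set Implicit Arguments.
Unset Strict Implicit.
Unset Printing Implicit Defensive.

Local Open Scope quotient_scope.
Local Open Scope group_scope.
Local Open Scope classical_set_scope.

(* The letter (i, true) is the Artin generator sigma_(i+1), which crosses the
   strands in positions i and i+1 (counted from 0); (i, false) is its inverse.
   A word is a braid diagram read from top to bottom. *)
Notation letter k := ('I_k.-1 * bool)%type.
Notation word k := (seq (letter k)).

Definition flip k (l : letter k) : letter k := (l.1, ~~ l.2).

Inductive braid_eqv (k : nat) : word k -> word k -> Prop :=
| Braid_refl u : braid_eqv u u
| Braid_sym u v : braid_eqv u v -> braid_eqv v u
| Braid_trans u v w : braid_eqv u v -> braid_eqv v w -> braid_eqv u w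
| Braid_cat u v u' v' :
    braid_eqv u v -> braid_eqv u' v' -> braid_eqv (u ++ u') (v ++ v')
| Braid_cancel l : braid_eqv [:: l; flip l] [::]
| Braid_far (i j : 'I_k.-1) : i.+1 < j ->
    braid_eqv [:: (i, true); (j, true)] [:: (j, true); (i, true)]
| Braid_adj (i j : 'I_k.-1) : i.+1 = j :> nat ->
    braid_eqv [:: (i, true); (j, true); (i, true)]
              [:: (j, true); (i, true); (j, true)].

Definition braid_eqvb k : rel (word k) := fun u v => `[< braid_eqv u v >].

Lemma braid_eqvb_refl k : reflexive (@braid_eqvb k).
Proof. by move=> u; apply/asboolP; exact: Braid_refl. Qed.

Lemma braid_eqvb_sym k : symmetric (@braid_eqvb k).
Proof. by move=> u v; apply/asboolP/asboolP; exact: Braid_sym. Qed.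

Lemma braid_eqvb_trans k : transitive (@braid_eqvb k).
Proof.
by move=> v u w /asboolP uv /asboolP vw; apply/asboolP; exact: Braid_trans vw.
Qed.

Canonical braid_equiv k :=
  EquivRel (@braid_eqvb k) (@braid_eqvb_refl k) (@braid_eqvb_sym k)
    (@braid_eqvb_trans k).

Definition braid (k : nat) := {eq_quot (braid_equiv k)}.
HB.instance Definition _ k := Choice.on (braid k).
HB.instance Definition _ k := EqQuotient.on (braid k).

Definition to_braid k (w : word k) : braid k := \pi_(braid k) w.

Definition word_of k (b : braid k) : word k := generic_quotient.repr b.

Lemma to_braidP k (u v : word k) : to_braid u = to_braid v <-> braid_eqv u v.
Proof.
split=> [/eqP | uv]; first by rewrite eqmodE => /asboolP.
by apply/eqP; rewrite eqmodE; apply/asboolP.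
Qed.

Lemma word_ofK k (b : braid k) : to_braid (word_of b) = b.
Proof. exact: reprK. Qed.

Lemma word_of_to_braid k (w : word k) : braid_eqv (word_of (to_braid w)) w.
Proof. by apply/to_braidP; rewrite word_ofK. Qed.

Definition winv k (w : word k) : word k := rev (map (@flip k) w).

Lemma flipK k : involutive (@flip k).
Proof. by case=> i b; rewrite /flip negbK. Qed.

Lemma winvK k : involutive (@winv k).
Proof. by move=> w; rewrite /winv map_rev revK (mapK (@flipK k)). Qed.

Lemma winvr k (w : word k) : braid_eqv (w ++ winv w) [::].
Proof.
elim: w => [|l w IHw]; first exact: Braid_refl.
rewrite /winv /= rev_cons -cats1 -/(winv w) catA -cat1s.
apply: (@Braid_trans _ _ ([:: l] ++ [::] ++ [:: flip l])).
  by apply: Braid_cat; [exact: Braid_refl | apply: Braid_cat => //; exact: Braid_refl].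
exact: Braid_cancel.
Qed.

Lemma winv_eqv k (u v : word k) : braid_eqv u v -> braid_eqv (winv u) (winv v).
Proof.
move=> uv; have R := @Braid_refl k.
apply: (@Braid_trans _ _ (winv u ++ (v ++ winv v))).
  rewrite -[X in braid_eqv X _]cats0; apply: Braid_cat => //.
  exact/Braid_sym/winvr.
apply: (@Braid_trans _ _ ((winv u ++ u) ++ winv v)).
  rewrite catA; apply: Braid_cat => //; apply: Braid_cat => //.
  exact: Braid_sym.
rewrite -[X in braid_eqv _ X]cat0s; apply: Braid_cat => //.
by rewrite -[X in _ ++ X]winvK; exact: winvr.
Qed.

Section BraidGroup.
Variable k : nat.
Implicit Types b c d : braid k.

Definition braid_one : braid k := to_braid [::].
Definition braid_mul b c : braid k := to_braid (word_of b ++ word_of c).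
Definition braid_inv b : braid k := to_braid (winv (word_of b)).

Lemma braid_mulE (u v : word k) :
  braid_mul (to_braid u) (to_braid v) = to_braid (u ++ v).
Proof. by apply/to_braidP/Braid_cat; exact: word_of_to_braid. Qed.

Lemma braid_invE (u : word k) : braid_inv (to_braid u) = to_braid (winv u).
Proof. by apply/to_braidP/winv_eqv; exact: word_of_to_braid. Qed.

Lemma braid_mulA : associative braid_mul.
Proof.
move=> b c d; rewrite -(word_ofK b) -(word_ofK c) -(word_ofK d).
by rewrite !braid_mulE catA.
Qed.

Lemma braid_mul1l : left_id braid_one braid_mul.
Proof. by move=> b; rewrite -(word_ofK b) braid_mulE. Qed.

Lemma braid_mul1r : right_id braid_one braid_mul.
Proof. by move=> b; rewrite -(word_ofK b) braid_mulE cats0. Qed.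

Lemma braid_mulVl : left_inverse braid_one braid_inv braid_mul.
Proof.
move=> b; rewrite -(word_ofK b) braid_invE braid_mulE; apply/to_braidP.
by rewrite -[X in _ ++ X]winvK; exact: winvr.
Qed.

Lemma braid_mulVr : right_inverse braid_one braid_inv braid_mul.
Proof.
move=> b; rewrite -(word_ofK b) braid_invE braid_mulE; apply/to_braidP.
exact: winvr.
Qed.

HB.instance Definition _ := isGroup.Build (braid k)
  braid_mulA braid_mul1l braid_mul1r braid_mulVl braid_mulVr.

End BraidGroup.

Lemma to_braidM k (u v : word k) : to_braid (u ++ v) = to_braid u * to_braid v.
Proof. by rewrite -braid_mulE. Qed.

Section Positions.
Variable k : nat.
Implicit Types (i j : 'I_k.-1) (l : letter k) (u v w : word k).

Lemma upper_subproof i : i.+1 < k.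
Proof. by case: k i => [[]|k' i] //=; rewrite ltnS. Qed.

Definition lower i : 'I_k := widen_ord (leq_pred k) i.
Definition upper i : 'I_k := Ordinal (upper_subproof i).

Definition letter_perm l : 'S_k := tperm (lower l.1) (upper l.1).

(* Permutations are composed from left to right, so the strand that starts in
   position x ends in position word_perm w x. *)
Definition word_perm w : 'S_k := \prod_(l <- w) letter_perm l.

Lemma word_perm_cat u v : word_perm (u ++ v) = word_perm u * word_perm v.
Proof. exact: big_cat. Qed.

Lemma word_perm_cons l w : word_perm (l :: w) = letter_perm l * word_perm w.
Proof. exact: big_cons. Qed.

Lemma word_perm_nil : word_perm [::] = 1.
Proof. exact: big_nil. Qed.

Lemma word_perm_eqv u v : braid_eqv u v -> word_perm u = word_perm v.
Proof.
elim=> {u v} [//|u v _ //|u v w _ -> _ //|u v u' v' _ Eu _ Ev|l|i j ij|i j ij].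
- by rewrite !word_perm_cat Eu Ev.
- by rewrite !word_perm_cons word_perm_nil /letter_perm /= mulg1 tperm2.
- rewrite !word_perm_cons word_perm_nil !mulg1 /letter_perm /= conjgC tpermJ.
  by rewrite !tpermD // -val_eqE /=; apply/eqP; lia.
- rewrite !word_perm_cons word_perm_nil !mulg1 /letter_perm /=.
  have <- : upper i = lower j by apply: val_inj.
  have E a b c : a != b -> b != c -> a != c ->
      tperm a b * (tperm b c * tperm a b) = tperm a c :> 'S_k.
    move=> ab bc ac; rewrite -{1}(tpermV a b) -/(conjg _ _) tpermJ tpermR.
    by rewrite tpermD // eq_sym.
  rewrite E; [|by rewrite -val_eqE /=; apply/eqP; lia..].
  rewrite (tpermC (lower i)) (tpermC (upper i)) E; first exact: tpermC.
  all: by rewrite -val_eqE /=; apply/eqP; lia.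
Qed.

Definition braid_perm (b : braid k) : 'S_k := word_perm (word_of b).

Lemma braid_permE w : braid_perm (to_braid w) = word_perm w.
Proof. exact/word_perm_eqv/word_of_to_braid. Qed.

Lemma braid_permM (b c : braid k) :
  braid_perm (b * c) = braid_perm b * braid_perm c.
Proof.
by rewrite -(word_ofK b) -(word_ofK c) -to_braidM !braid_permE word_perm_cat.
Qed.

End Positions.

Section KeepStrands.
Variables k m : nat.
Implicit Types (S : {set 'I_k}) (i j : 'I_k.-1) (l : letter k).
Implicit Types (u v w : word k).

Definition strands_left S (p : nat) : nat := #|[set x in S | x < p]%SET|.

(* The diagram left when all the strands of w are removed but those that start
   in the positions in S, where #|S| = m.  As the diagram is read, S is updated
   to the current positions of these strands.  A crossing disappears unless both
   its strands are kept, and then its new position is the number of kept strands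
   on its left.  This number is less than m.-1, so insub does not fail. *)
Fixpoint keep_word S w : word m :=
  if w isn't l :: w' then [::] else
  (if (lower l.1 \in S) && (upper l.1 \in S) then
     if insub (strands_left S (lower l.1)) is Some j then [:: (j, l.2)]
     else [::]
   else [::])
  ++ keep_word (letter_perm l @: S)%SET w'.

Lemma keep_word_cat S u v :
  keep_word S (u ++ v) = keep_word S u ++ keep_word (word_perm u @: S)%SET v.
Proof.
elim: u S => [|l u IHu] S /=.
  by rewrite word_perm_nil (eq_imset _ (@perm1 _)) imset_id.
rewrite IHu catA word_perm_cons -imset_comp; congr (_ ++ keep_word _ _).
by apply: eq_imset => x /=; rewrite permM.
Qed.

Lemma in_letter_perm S l x :
  (x \in (letter_perm l @: S)%SET) = (letter_perm l x \in S).
Proof. by rewrite -{1}(tpermK _ _ x : letter_perm l (letter_perm l x) = x)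
  mem_imset //; exact: perm_inj. Qed.

Lemma strands_leftS S (x : 'I_k) p : x = p :> nat ->
  strands_left S p.+1 = strands_left S p + (x \in S).
Proof.
move=> <-; rewrite /strands_left; have [xS|xS] := boolP (x \in S).
- rewrite addn1 (cardsD1 x) !inE xS ltnSn add1n; congr _.+1.
  apply: eq_card => y; rewrite !inE ltnS leq_eqVlt -(val_eqE y x).
  by case: ltngtP; rewrite ?andbF ?andbT.
- rewrite addn0; apply: eq_card => y; rewrite !inE ltnS leq_eqVlt val_eqE.
  by case: eqP => [->|//]; rewrite (negbTE xS).
Qed.

Lemma strands_left_perm S l p : p != l.1.+1 ->
  strands_left (letter_perm l @: S)%SET p = strands_left S p.
Proof.
move=> pl; rewrite /strands_left -[RHS](card_imset _ (@perm_inj _ (letter_perm l))).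
apply: eq_card => y; rewrite in_letter_perm !inE in_letter_perm; congr andb.
rewrite /letter_perm; case: tpermP => [->|->|//] /=; lia.
Qed.

Lemma strands_left_mono S p q : p <= q -> strands_left S p <= strands_left S q.
Proof.
move=> pq; apply/subset_leq_card/fintype.subsetP => x; rewrite !inE => /andP[-> /=].
by move=> /leq_trans; apply.
Qed.

Lemma strands_left_max S p : strands_left S p <= #|S|.
Proof. by apply/subset_leq_card/fintype.subsetP => x; rewrite !inE => /andP[]. Qed.

Lemma strands_left_crossing S i : lower i \in S -> upper i \in S ->
  strands_left S i.+2 = (strands_left S i).+2.
Proof.
move=> li ui; rewrite (@strands_leftS _ (upper i)) //.
by rewrite (@strands_leftS _ (lower i)) // li ui !addn1.
Qed.

Lemma keep_word_eqv S u v : #|S| = m ->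
  braid_eqv u v -> braid_eqv (keep_word S u) (keep_word S v).
Proof.
move=> Sm uv; elim: uv S Sm
  => {u v} [u|u v _ IH|u v w _ IH1 _ IH2|u v u' v' uv IHu _ IHv|l|i j ij|i j ij] S Sm.
- exact: Braid_refl.
- exact/Braid_sym/IH.
- exact: Braid_trans (IH1 _ Sm) (IH2 _ Sm).
- rewrite !keep_word_cat -(word_perm_eqv uv); apply: Braid_cat; first exact: IHu.
  by apply: IHv; rewrite card_imset //; exact: perm_inj.
- rewrite /= !in_letter_perm /letter_perm tpermL tpermR andbC.
  rewrite -/(letter_perm l) strands_left_perm /=; last by apply/eqP; lia.
  case: ifP => _; last exact: Braid_refl.
  case: insub => [r|]; last exact: Braid_refl.
  exact: (Braid_cancel (r, l.2)).
- rewrite /= !in_letter_perm !strands_left_perm /=; try by apply/eqP; lia.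
  rewrite /letter_perm /= !tpermD; try by rewrite -val_eqE /=; apply/eqP; lia.
  case: ifP => [/andP[li ui]|_]; last by rewrite /= cats0; exact: Braid_refl.
  case: ifP => [/andP[lj uj]|_]; last by rewrite /= cats0; exact: Braid_refl.
  have ri := strands_left_crossing li ui.
  have rj := strands_left_crossing lj uj.
  have := strands_left_mono S (ij : i.+2 <= j).
  have := strands_left_max S j.+2; rewrite Sm ri rj => jm ltij.
  have Hi : strands_left S i < m.-1 by lia.
  have Hj : strands_left S j < m.-1 by lia.
  by rewrite (insubT (fun x => x < m.-1) Hi) (insubT (fun x => x < m.-1) Hj) /=;
    apply: Braid_far => /=; lia.
- rewrite /= !in_letter_perm /letter_perm /=.
  have Ej : lower j = upper i by apply: val_inj.
  have ab : lower i != upper i by rewrite -val_eqE /=; apply/eqP; lia.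
  have bc : upper i != upper j by rewrite -val_eqE /=; apply/eqP; lia.
  have ac : lower i != upper j by rewrite -val_eqE /=; apply/eqP; lia.
  have ca : upper j != lower i by rewrite eq_sym.
  have ba : upper i != lower i by rewrite eq_sym.
  have r1 : strands_left (letter_perm (i, true) @: S)%SET j
            = strands_left S i + (upper i \in S).
    rewrite -ij (@strands_leftS _ (lower i)) // strands_left_perm /=; last lia.
    by rewrite in_letter_perm /letter_perm tpermL.
  have r2 : strands_left
      (letter_perm (j, true) @: (letter_perm (i, true) @: S))%SET i
      = strands_left S i by rewrite !strands_left_perm //=; lia.
  have r3 : strands_left S j = strands_left S i + (lower i \in S).
    by rewrite -ij (@strands_leftS _ (lower i)).
  have r4 : strands_left (letter_perm (j, true) @: S)%SET i = strands_left S i.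
    by rewrite strands_left_perm //=; lia.
  have r5 : strands_left
      (letter_perm (i, true) @: (letter_perm (j, true) @: S))%SET j
      = strands_left S i + (upper j \in S).
    rewrite -ij (@strands_leftS _ (lower i)) // !strands_left_perm //=; try lia.
    by rewrite !in_letter_perm /letter_perm /= !(tpermL, tpermR) Ej tpermL.
  rewrite /letter_perm /= in r1 r2 r3 r4 r5.
  rewrite r1 r2 r3 r4 r5 Ej.
  have E1 : tperm (upper i) (upper j) (lower i) = lower i by rewrite tpermD.
  have E2 : tperm (lower i) (upper i) (upper j) = upper j by rewrite tpermD.
  rewrite !(tpermL, tpermR, E1, E2).
  set r := strands_left S i.
  have rm : lower i \in S -> upper i \in S -> upper j \in S ->
      r < m.-1 /\ r.+1 < m.-1.
    move=> li ui uj; have ri := strands_left_crossing li ui.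
    have := strands_left_max S j.+2.
    rewrite (@strands_leftS _ (upper j)) // uj -ij ri Sm -/r; lia.
  case: (lower i \in S) rm; case: (upper i \in S); case: (upper j \in S) => /= rm;
    rewrite ?addn0 ?addn1 ?cats0; try exact: Braid_refl.
  have [Hi Hj] := rm isT isT isT.
  rewrite (insubT (fun x => x < m.-1) Hi) (insubT (fun x => x < m.-1) Hj) /=.
  exact: Braid_adj.
Qed.

End KeepStrands.

(* A presentation of M by the closure of a braid on m strands.  In the first
   case M is the complement in S^3 of the closure, oriented by the strands; in
   the second case M is obtained by integral surgery on S^3 along the closure.
   The components of the closure of B are the cycles of braid_perm B, hence the
   type of the framing. *)
Variant presented_manifold (m : nat) : Type :=
| LinkComplement of braid m
| IntegralSurgery (B : braid m) of
    ({c : {set 'I_m} | c \in porbits (braid_perm B)} -> int).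

Definition fixed_braid m (M : presented_manifold m) : braid m :=
  match M with LinkComplement B => B | IntegralSurgery B _ => B end.

Section MixedBraids.
Variables m n : nat.
Implicit Type b : braid (m + n).

(* This is defined for every braid, the end positions of the remaining strands
   being renumbered in increasing order.  So whether these strands end in the
   first m positions is a separate condition on braid_perm. *)
Definition remove_last b : braid m :=
  to_braid (keep_word m [set lshift n i | i : 'I_m]%SET (word_of b)).

Lemma remove_lastE (w : word (m + n)) :
  remove_last (to_braid w) =
  to_braid (keep_word m [set lshift n i | i : 'I_m]%SET w).
Proof.
apply/to_braidP/keep_word_eqv; last exact: word_of_to_braid.
by rewrite card_imset ?card_ord //; exact: lshift_inj.
Qed.

Definition identity_mixed_braids : set (braid (m + n)) :=
  [set b | (forall i : 'I_m, braid_perm b (lshift n i) = lshift n i)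
           /\ remove_last b = 1].

Definition mixed_braids (M : presented_manifold m) : set (braid (m + n)) :=
  [set b | (forall i : 'I_m, braid_perm b (lshift n i) < m)
           /\ remove_last b = fixed_braid M].

End MixedBraids.

Arguments identity_mixed_braids : clear implicits.
Arguments mixed_braids [m] n M.

(* Main.v *)
(* Removing the last n strands is multiplicative on the braids whose permutation
   preserves the first m positions, and the permutation of what is left is the
   permutation that such a braid induces on these positions.  The fixed braid B,
   followed on its right by n vertical strands, is a mixed braid g, and b is
   mixed exactly when b g^-1 preserves the first m positions and leaves the
   trivial braid; the latter forces b g^-1 to fix each of these positions. *)
Require Import Defs.
From mathcomp Require Import all_boot all_fingroup.
From mathcomp Require Import boolp classical_sets zify.

Set Implicit Arguments.
Unset Strict Implicit.
Unset Printing Implicit Defensive.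

Local Open Scope group_scope.

Section KeepPermutation.
Variables k m : nat.
Implicit Types (S : {set 'I_k}) (l : letter k) (w : word k).

(** A kept strand in position [x] has rank [strands_left S x] among the kept strands, and this rank
    is its position in the reduced diagram. A crossing of two kept strands swaps their consecutive
    ranks; any other crossing changes no rank. *)
Lemma strands_left_keep_letter S l (x : 'I_k) (y : 'I_m) :
    #|S| = m -> x \in S -> y = strands_left S x :> nat ->
  word_perm (keep_word m S [:: l]) y
  = strands_left (letter_perm l @: S)%SET (letter_perm l x) :> nat.
Proof.
move=> Sm xS yx; rewrite /= cats0.
set i := l.1; set r := strands_left S i.
have lowerS T : strands_left T i.+1 = strands_left T i + (lower i \in T).
  exact: (@strands_leftS _ T (lower i)).
have r' : strands_left (letter_perm l @: S)%SET i = r.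
  by rewrite strands_left_perm //= -/i; lia.
have lowerE : (lower i \in (letter_perm l @: S)%SET) = (upper i \in S).
  by rewrite in_letter_perm /letter_perm tpermL.
case: ifP => [/andP[li ui]|both].
- have r2 := strands_left_crossing li ui.
  have := strands_left_max S i.+2; rewrite Sm r2 -/r => rm.
  have Hr : r < m.-1 by lia.
  rewrite (insubT (fun p => p < m.-1) Hr) /= word_perm_cons word_perm_nil mulg1.
  have Er : r = lower (Ordinal Hr) :> nat by [].
  have [xl|xl] := eqVneq x (lower i).
    have -> : y = lower (Ordinal Hr) by apply: val_inj; rewrite /= yx xl.
    by rewrite xl /letter_perm !tpermL /= lowerS lowerE r' ui addn1.
  have [xu|xu] := eqVneq x (upper i).
    have -> : y = upper (Ordinal Hr).
      by apply: val_inj; rewrite /= yx xu /= lowerS li addn1.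
    by rewrite xu /letter_perm !tpermR.
  have xi : x != i :> nat by rewrite -(val_eqE x (lower i)) in xl.
  have xi1 : x != i.+1 :> nat by rewrite -(val_eqE x (upper i)) in xu.
  rewrite [letter_perm l x]tpermD; try by rewrite eq_sym.
  rewrite strands_left_perm // -yx.
  (* A third kept strand lies entirely to the left or to the right of the crossing, so by
     monotonicity its rank avoids [r] and [r.+1]. *)
  have yr : y < r \/ r.+1 < y.
    rewrite yx; case: (ltnP x i) => ix.
      left; have := strands_left_mono S ix.
      by rewrite (@strands_leftS _ S x) // xS addn1.
    right; have ix2 : i.+2 <= x by lia.
    by have := strands_left_mono S ix2; rewrite r2.
  by rewrite tpermD // -val_eqE /=; lia.
(* Here at most one strand of the crossing is kept, and passing a removed strand leaves its rank
   unchanged. *)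
- rewrite word_perm_nil perm1 yx.
  have [xl|xl] := eqVneq x (lower i).
    rewrite xl in xS *; rewrite xS /= in both.
    by rewrite /letter_perm tpermL /= lowerS lowerE both addn0.
  have [xu|xu] := eqVneq x (upper i).
    rewrite xu in xS *; rewrite xS andbT in both.
    by rewrite /letter_perm tpermR /= r' lowerS both addn0.
  rewrite [letter_perm l x]tpermD; try by rewrite eq_sym.
  have xi1 : x != i.+1 :> nat by rewrite -(val_eqE x (upper i)) in xu.
  by rewrite strands_left_perm.
Qed.

(** Iterates the one-crossing case; the kept set moves along with its strands and retains its
    cardinality. *)
Lemma strands_left_keep_word S w (x : 'I_k) (y : 'I_m) :
    #|S| = m -> x \in S -> y = strands_left S x :> nat ->
  word_perm (keep_word m S w) y
  = strands_left (word_perm w @: S)%SET (word_perm w x) :> nat.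
Proof.
elim: w S x y => [|l w IHw] S x y Sm xS yx.
  by rewrite /= !word_perm_nil !perm1 (eq_imset _ (@perm1 _)) imset_id.
rewrite word_perm_cons permM -[in LHS]cat1s keep_word_cat word_perm_cat permM.
rewrite [word_perm [:: l]]word_perm_cons word_perm_nil mulg1.
have -> : ((letter_perm l * word_perm w)%g @: S
           = word_perm w @: (letter_perm l @: S))%SET.
  by rewrite -imset_comp; apply: eq_imset => z /=; rewrite permM.
apply: IHw; first by rewrite card_imset //; exact: perm_inj.
  by rewrite imset_f.
exact: strands_left_keep_letter.
Qed.

End KeepPermutation.

Section FirstStrands.
Variables m n : nat.
Implicit Types (b c : braid (m + n)) (s : 'S_(m + n)).

Let first_strands : {set 'I_(m + n)} := [set lshift n i | i : 'I_m]%SET.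

Lemma in_first_strands (x : 'I_(m + n)) : (x \in first_strands) = (x < m).
Proof.
apply/imsetP/idP => [[i _ ->]|xm]; first exact: (ltn_ord i).
by exists (Ordinal xm) => //; apply: val_inj.
Qed.

Lemma card_first_strands : #|first_strands| = m.
Proof. by rewrite card_imset ?card_ord //; exact: lshift_inj. Qed.

(** Every position below [m] is kept, so the renumbering is trivial there. *)
Lemma strands_left_first (p : nat) :
  p <= m -> strands_left first_strands p = p.
Proof.
elim: p => [|p IHp] pm; first by apply: eq_card0 => x; rewrite !inE ltn0 andbF.
have pmn : p < m + n by lia.
rewrite (@strands_leftS _ _ (Ordinal pmn)) // in_first_strands pm.
by rewrite IHp ?addn1 // ltnW.
Qed.

Definition preserves_first s := forall i : 'I_m, s (lshift n i) < m.

(** An injection of a finite set into itself is onto; this also gives stability under inverses. *)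
Lemma preserves_first_imset s :
  preserves_first s -> (s @: first_strands)%SET = first_strands.
Proof.
move=> ps; apply/eqP; rewrite eqEcard (card_imset _ (@perm_inj _ s)) leqnn andbT.
apply/fintype.subsetP => _ /imsetP[_ /imsetP[i _ ->] ->].
by rewrite in_first_strands.
Qed.

Lemma preserves_firstM s t :
  preserves_first s -> preserves_first t -> preserves_first (s * t).
Proof.
move=> ps pt i; rewrite permM.
by have := pt (Ordinal (ps i)); congr (t _ < m); apply: val_inj.
Qed.

Lemma preserves_firstV s : preserves_first s -> preserves_first s^-1.
Proof.
move=> ps i; have : lshift n i \in first_strands by apply: imset_f.
rewrite -{1}(preserves_first_imset ps) => /imsetP[x xF ->].
by rewrite permK -in_first_strands.
Qed.

Lemma braid_perm1 : braid_perm (1 : braid (m + n)) = 1.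
Proof. by rewrite [1]/(to_braid [::]) braid_permE word_perm_nil. Qed.

Lemma braid_permV b : braid_perm b^-1 = (braid_perm b)^-1.
Proof. by apply: (mulgI (braid_perm b)); rewrite -braid_permM !mulgV braid_perm1. Qed.

Lemma remove_last1 : remove_last (1 : braid (m + n)) = 1.
Proof. by rewrite [1 in LHS]/(to_braid [::]) remove_lastE. Qed.

(** After [b] the kept strands fill the first [m] positions again, so reading [c] starts from the
    same kept set. *)
Lemma remove_lastM b c : preserves_first (braid_perm b) ->
  remove_last (b * c) = remove_last b * remove_last c.
Proof.
rewrite -(word_ofK b) -(word_ofK c) -to_braidM braid_permE !remove_lastE => pb.
by rewrite keep_word_cat (preserves_first_imset pb) to_braidM.
Qed.

Lemma remove_lastV b : preserves_first (braid_perm b) ->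
  remove_last b^-1 = (remove_last b)^-1.
Proof.
move=> pb; apply: (mulgI (remove_last b)).
by rewrite -remove_lastM // !mulgV remove_last1.
Qed.

Lemma braid_perm_remove_last b (i : 'I_m) : preserves_first (braid_perm b) ->
  braid_perm b (lshift n i) = lshift n (braid_perm (remove_last b) i).
Proof.
rewrite -(word_ofK b) remove_lastE !braid_permE => pb; apply: val_inj => /=.
rewrite (@strands_left_keep_word _ _ _ _ (lshift n i)) ?card_first_strands //.
- by rewrite preserves_first_imset // strands_left_first // ltnW.
- exact: imset_f.
- by rewrite strands_left_first //= ltnW.
Qed.

(** Puts membership in the subgroup in the same form as membership in [mixed_braids], so that both
    can be checked by multiplicativity. *)
Lemma identity_mixed_braidsP b : identity_mixed_braids m n b <->
  preserves_first (braid_perm b) /\ remove_last b = 1.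
Proof.
split=> [[fb rb]|[pb rb]]; split=> // i; first by rewrite fb /=.
rewrite braid_perm_remove_last // rb.
by rewrite [1 : braid m]/(to_braid [::]) braid_permE word_perm_nil perm1.
Qed.

Lemma leq_pred_addr : m.-1 <= (m + n).-1.
Proof. lia. Qed.

Definition add_strands (w : word m) : word (m + n) :=
  [seq (widen_ord leq_pred_addr l.1, l.2) | l <- w].

Lemma letter_add_strands (l : letter m) :
  preserves_first (letter_perm (widen_ord leq_pred_addr l.1, l.2)).
Proof.
by move=> i; rewrite /letter_perm; case: tpermP => //= _; case: l.1 => /= j; lia.
Qed.

Lemma preserves_add_strands (w : word m) :
  preserves_first (word_perm (add_strands w)).
Proof.
elim: w => [|l w IHw]; first by move=> i; rewrite word_perm_nil perm1 /=.
by rewrite word_perm_cons; apply: preserves_firstM => //; exact: letter_add_strands.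
Qed.

(** Every crossing has both strands kept and its index equals the number of strands on its left, so
    the words agree letter by letter. *)
Lemma keep_add_strands (w : word m) :
  keep_word m first_strands (add_strands w) = w.
Proof.
elim: w => [//|[i e] w IHw].
rewrite [LHS]/= !in_first_strands /=.
have im := ltn_ord i.
have -> : i < m by lia.
have -> : i.+1 < m by lia.
rewrite strands_left_first /=; last by lia.
rewrite (insubT (fun p => p < m.-1) im) /=.
rewrite (preserves_first_imset (@letter_add_strands (i, e))) IHw.
by congr ((_, _) :: _); apply: val_inj.
Qed.

End FirstStrands.

Theorem proposition1 (m n : nat) (m_gt0 : 0 < m) (n_gt0 : 0 < n)
    (M : presented_manifold m) :
  group_closed (mem (identity_mixed_braids m n)) /\
  exists g : braid (m + n),
    mixed_braids n M = [set (h * g)%g | h in identity_mixed_braids m n]%classic.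
Proof.
split.
  (* The one-step subgroup test: the unit, then [b * c^-1]. *)
  split=> [|b c]; rewrite ?inE !identity_mixed_braidsP.
    by rewrite braid_perm1 remove_last1; split=> // i; rewrite perm1 /=.
  move=> [pb rb] [pc rc]; rewrite braid_permM braid_permV; split.
    by apply: preserves_firstM => //; exact: preserves_firstV.
  by rewrite remove_lastM // remove_lastV // rb rc mulgV.
set B := fixed_braid M; set g := to_braid (add_strands n (word_of B)).
have pg : preserves_first (braid_perm g).
  by rewrite braid_permE; exact: preserves_add_strands.
have rg : remove_last g = B by rewrite remove_lastE keep_add_strands word_ofK.
exists g; apply/seteqP; split=> [b [pb rb]|_ [h /identity_mixed_braidsP[ph rh] <-]].
- exists (b * g^-1); last by rewrite mulgVK.
  apply/identity_mixed_braidsP; rewrite braid_permM braid_permV; split.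
    by apply: preserves_firstM => //; exact: preserves_firstV.
  by rewrite remove_lastM // remove_lastV // rg rb mulgV.
- split; first by rewrite braid_permM; exact: preserves_firstM.
  by rewrite remove_lastM // rh rg mul1g.
Qed.
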